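(* For all real $x$ with $|x|<\frac{\pi}{2}$, $$\left(\frac{\pi^2}{\pi^2-4x^2}\right)^{\frac{\pi^2}{12}}\leq\frac{\tan x}{x}\leq\left(\frac{\pi^2}{\pi^2-4x^2}\right)^{1}.$$ Moreover the exponents $\frac{\pi^2}{12}$ and $1$ are best possible: $\frac{\pi^2}{12}$ is the largest real exponent for which the left-hand inequality holds for all $|x|<\frac{\pi}{2}$, and $1$ is the smallest real exponent for which the right-hand inequality holds for all $|x|<\frac{\pi}{2}$.
   Context: The function $\frac{\tan x}{x}$ is understood to equal its limit $1$ at $x=0$. *)

(* Defs.v *)
From Stdlib Require Export Reals.
Open Scope R_scope.

Definition tan_over_id (x : R) : R :=
  if Req_dec_T x 0 then 1 else tan x / x.

(* For |x| < PI/2 this is at least 1, hence positive, so that [Rpower] applied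
   to it is the genuine real power. *)
Definition pi_ratio (x : R) : R := PI ^ 2 / (PI ^ 2 - 4 * x ^ 2).

(* Main.v *)
(** The function log(tan x / x) - a log(PI^2 / (PI^2 - 4 x^2)) vanishes at 0, and with
    y = 2x its derivative is 2/sin y - 2/y - 4 a y / (PI^2 - y^2). For a = PI^2/12 this
    is nonnegative iff sin y <= 6 y (PI^2 - y^2) / (6 PI^2 + (PI^2 - 6) y^2), and for
    a = 1 it is nonpositive iff Redheffer's inequality
    sin y >= y (PI^2 - y^2) / (PI^2 + y^2) holds. Both rational bounds follow on (0, PI)
    from Taylor polynomials of sin at 0 (for y <= 2) and at PI (for y > 2).
    The exponent PI^2/12 is optimal by second-order expansion at 0, and 1 is optimal
    because both sides have a simple pole at PI/2. *)

Require Import Defs.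
From Stdlib Require Import Reals Lra Psatz Machin.
From Coquelicot Require Import Coquelicot.
Open Scope R_scope.

(** * Numerical bounds on [PI] and Taylor bounds on sine and cosine *)

Lemma PI_bounds : 314/100 < PI < 315/100.
Proof.
  destruct (PI_2_3_7_ineq 1) as [H1 H2].
  unfold tg_alt, PI_2_3_7_tg, Ratan_seq in *. simpl in *.
  split; lra.
Qed.

Lemma sin_le_poly5 (y : R) : 0 <= y <= 4 -> sin y <= y - y ^ 3 / 6 + y ^ 5 / 120.
Proof.
  intros [H0 H4]. destruct (pre_sin_bound y 0 H0 H4) as [_ H].
  unfold sin_approx, sin_term in H. simpl in H. simpl. lra.
Qed.

Lemma sin_ge_poly3 (y : R) : 0 <= y <= 4 -> y - y ^ 3 / 6 <= sin y.
Proof.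
  intros [H0 H4]. destruct (pre_sin_bound y 0 H0 H4) as [H _].
  unfold sin_approx, sin_term in H. simpl in H. simpl. lra.
Qed.

Lemma sin_ge_poly7 (y : R) : 0 <= y <= 4 ->
  y - y ^ 3 / 6 + y ^ 5 / 120 - y ^ 7 / 5040 <= sin y.
Proof.
  intros [H0 H4]. destruct (pre_sin_bound y 1 H0 H4) as [H _].
  unfold sin_approx, sin_term in H. simpl in H. simpl. lra.
Qed.

Lemma cos_ge_poly2 (y : R) : -2 <= y <= 2 -> 1 - y ^ 2 / 2 <= cos y.
Proof.
  intros [H0 H4]. destruct (pre_cos_bound y 0 H0 H4) as [H _].
  unfold cos_approx, cos_term in H. simpl in H. simpl. lra.
Qed.

Lemma sin_PI_minus (t : R) : sin (PI - t) = sin t.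
Proof. rewrite sin_minus, sin_PI, cos_PI. ring. Qed.

(** * Rational bounds for sine on [(0, PI)] *)

Lemma sin_le_rational_near_PI (p t : R) : 3.14 < p < 3.15 -> 0 < t < 1.15 ->
  (1 - t ^ 2 / 6 + t ^ 4 / 120) * (6 * p ^ 2 + (p ^ 2 - 6) * (p - t) ^ 2)
    <= 6 * (p - t) * (2 * p - t).
Proof.
  intros Hp Ht.
  assert (HP : 9.85 < p ^ 2 < 9.9225) by nra.
  assert (H2 : 0 < t ^ 2 <= 1.3225) by nra.
  (* Since [t < 1.15], the quartic term is absorbed into the quadratic one: [0.1556] lies just below
     [1/6 - 1.15^2/120]. *)
  apply Rle_trans with ((1 - 0.1556 * t ^ 2) * (6 * p ^ 2 + (p ^ 2 - 6) * (p - t) ^ 2)).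
  { apply Rmult_le_compat_r; nra. }
  (* The difference of the two sides, as a polynomial in [t], is bounded below
     coefficient by coefficient. *)
  assert (C0 : 20.6 <= p ^ 2 * (12 - p ^ 2)) by nra.
  assert (C1 : -32.3 <= - 18 * p + 2 * p * (p ^ 2 - 6)) by nra.
  assert (C2 : 17.2 <= 12 - p ^ 2 + 0.1556 * (p ^ 2 * p ^ 2)) by nra.
  assert (C3 : -3.87 <= - 0.1556 * 2 * p * (p ^ 2 - 6)) by nra.
  assert (C4 : 0 <= 0.1556 * (p ^ 2 - 6)) by lra.
  apply (Rmult_le_compat_l t) in C1; [|lra].
  apply (Rmult_le_compat_l (t ^ 2)) in C2; [|lra].
  apply (Rmult_le_compat_l (t ^ 3)) in C3; [|apply pow_le; lra].
  apply (Rmult_le_compat_l (t ^ 4)) in C4; [|apply pow_le; lra].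
  (* This folds the cubic term into the quadratic one, as [17.2 - 3.87 * 1.15 > 12.749]; the
     resulting quadratic has negative discriminant. *)
  assert (t ^ 3 <= 1.15 * t ^ 2) by nra.
  assert (0 <= 20.6 - 32.3 * t + 12.749 * t ^ 2) by nra.
  lra.
Qed.

Lemma sin_le_rational (y : R) : 0 < y < PI ->
  sin y * (6 * PI ^ 2 + (PI ^ 2 - 6) * y ^ 2) <= 6 * y * (PI ^ 2 - y ^ 2).
Proof.
  intros [H0 H1]. pose proof PI_bounds as [Pl Pu].
  assert (HP : 9.85 < PI ^ 2 < 9.93) by nra.
  set (P := PI ^ 2) in *.
  assert (D : 0 < 6 * P + (P - 6) * y ^ 2) by nra.
  destruct (Rle_lt_dec y 2) as [Hy | Hy].
  - pose proof (sin_le_poly5 y ltac:(lra)) as Hs.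
    apply Rle_trans with ((y - y ^ 3 / 6 + y ^ 5 / 120) * (6 * P + (P - 6) * y ^ 2)).
    { apply Rmult_le_compat_r; lra. }
    (* In the difference of the two sides the terms in [y] and [y ^ 3] cancel, leaving [y ^ 5] times
       this factor. *)
    assert (Hk : 0 <= 7 * P / 60 - 1 - (P - 6) * y ^ 2 / 120) by nra.
    assert (0 <= y ^ 5 * (7 * P / 60 - 1 - (P - 6) * y ^ 2 / 120)).
    { apply Rmult_le_pos; [apply pow_le; lra | exact Hk]. }
    lra.
  - rewrite <- sin_PI_minus. set (t := PI - y).
    assert (Ht : 0 < t < 1.15) by (unfold t; lra).
    pose proof (sin_le_poly5 t ltac:(lra)) as Hs.
    apply Rle_trans with ((t - t ^ 3 / 6 + t ^ 5 / 120) * (6 * P + (P - 6) * y ^ 2)).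
    { apply Rmult_le_compat_r; lra. }
    (* Both sides vanish at [y = PI], that is at [t = 0]; the common factor [t] is split off and
       cancelled. *)
    replace (6 * y * (P - y ^ 2)) with (t * (6 * (PI - t) * (2 * PI - t)))
      by (unfold t, P; ring).
    replace (t - t ^ 3 / 6 + t ^ 5 / 120) with (t * (1 - t ^ 2 / 6 + t ^ 4 / 120)) by field.
    rewrite Rmult_assoc. apply Rmult_le_compat_l; [lra|].
    replace y with (PI - t) by (unfold t; ring).
    apply sin_le_rational_near_PI; lra.
Qed.

Lemma redheffer (y : R) : 0 < y < PI ->
  y * (PI ^ 2 - y ^ 2) <= sin y * (PI ^ 2 + y ^ 2).
Proof.
  intros [H0 H1]. pose proof PI_bounds as [Pl Pu].
  assert (HP : 9.85 < PI ^ 2 < 9.93) by nra.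
  set (P := PI ^ 2) in *.
  destruct (Rle_lt_dec y 2) as [Hy | Hy].
  - pose proof (sin_ge_poly7 y ltac:(lra)) as Hs.
    apply Rle_trans with ((y - y ^ 3 / 6 + y ^ 5 / 120 - y ^ 7 / 5040) * (P + y ^ 2)).
    2: { apply Rmult_le_compat_r; nra. }
    set (s := y ^ 2).
    assert (Hs' : 0 < s <= 4) by (unfold s; nra).
    (* This is the difference of the two sides divided by [y ^ 3]. Bounding its coefficients with
       [P] in [(9.85, 9.93)] and [s <= 4] leaves a quadratic in [s] of negative discriminant. *)
    assert (Hk : 0 <= 2 - P / 6 + s * (P / 120 - 1 / 6) + s ^ 2 * (1 / 120 - P / 5040) - s ^ 3 / 5040).
    { assert (s * -0.0846 <= s * (P / 120 - 1 / 6)) by (apply Rmult_le_compat_l; lra).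
      assert (s ^ 2 * 0.00556 <= s ^ 2 * (1 / 120 - P / 5040 - s / 5040))
        by (apply Rmult_le_compat_l; nra).
      nra. }
    assert (0 <= y * s * (2 - P / 6 + s * (P / 120 - 1 / 6) + s ^ 2 * (1 / 120 - P / 5040) - s ^ 3 / 5040)).
    { apply Rmult_le_pos; nra. }
    unfold s in *. lra.
  - rewrite <- sin_PI_minus. set (t := PI - y).
    assert (Ht : 0 < t < 1.15) by (unfold t; lra).
    pose proof (sin_ge_poly3 t ltac:(lra)) as Hs.
    apply Rle_trans with ((t - t ^ 3 / 6) * (P + y ^ 2)).
    2: { apply Rmult_le_compat_r; nra. }
    replace (y * (P - y ^ 2)) with (t * ((PI - t) * (2 * PI - t)))
      by (unfold t, P; ring).
    replace (t - t ^ 3 / 6) with (t * (1 - t ^ 2 / 6)) by field.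
    rewrite Rmult_assoc. apply Rmult_le_compat_l; [lra|].
    replace y with (PI - t) by (unfold t; ring).
    (* After cancelling [t], the difference of the two sides is [t / 6] times the slack in this
       inequality. *)
    assert (t * (2 * P - 2 * PI * t + t ^ 2) <= 6 * PI).
    { assert (t * t <= 1.15 * t) by nra.
      assert (2 * P - 2 * PI * t + t ^ 2 <= 19.86 - 5.13 * t) by nra.
      apply Rle_trans with (t * (19.86 - 5.13 * t)); [apply Rmult_le_compat_l|]; nra. }
    unfold P in *. nra.
Qed.

(** Mean value theorem. At the endpoints only continuity is asked for, because the derivative
    formula used for [log_gap] divides by [x] and so breaks down at [0]. *)
Lemma le_of_derive_nonneg (f df : R -> R) (a b : R) : a < b ->
  (forall x, a < x < b -> is_derive f x (df x)) ->
  (forall x, a <= x <= b -> continuity_pt f x) ->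
  (forall x, a < x < b -> 0 <= df x) -> f a <= f b.
Proof.
  intros Hab Hd Hc Hp.
  assert (pr1 : forall c, a < c < b -> derivable_pt f c).
  { intros c Hc'. exists (df c). apply is_derive_Reals. auto. }
  assert (pr2 : forall c, a < c < b -> derivable_pt id c).
  { intros c _. apply derivable_pt_id. }
  destruct (MVT f id a b pr1 pr2 Hab Hc) as (c & Pc & H).
  { intros. apply derivable_continuous_pt, derivable_pt_id. }
  rewrite (derive_pt_eq_0 f c (df c) (pr1 c Pc)) in H
    by (apply is_derive_Reals; auto).
  rewrite (derive_pt_eq_0 id c 1 (pr2 c Pc)) in H by apply derivable_pt_lim_id.
  unfold id in H. specialize (Hp c Pc). nra.
Qed.

Lemma pi_ratio_ge1 (x : R) : Rabs x < PI / 2 -> 1 <= pi_ratio x.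
Proof.
  intros Hx. apply Rabs_def2 in Hx. unfold pi_ratio.
  apply (Rmult_le_reg_r (PI ^ 2 - 4 * x ^ 2)); [nra|].
  unfold Rdiv. rewrite Rmult_assoc, Rinv_l; nra.
Qed.

Lemma pi_ratio_opp (x : R) : pi_ratio (- x) = pi_ratio x.
Proof. unfold pi_ratio. do 2 f_equal. ring. Qed.

Lemma pi_ratio_0 : pi_ratio 0 = 1.
Proof. unfold pi_ratio. field. apply PI_neq0. Qed.

Lemma tan_over_id_nz (x : R) : x <> 0 -> tan_over_id x = tan x / x.
Proof. intros Hx. unfold tan_over_id. destruct (Req_dec_T x 0); [contradiction|reflexivity]. Qed.

Lemma tan_over_id_0 : tan_over_id 0 = 1.
Proof. unfold tan_over_id. destruct (Req_dec_T 0 0); [reflexivity|contradiction]. Qed.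

Lemma tan_over_id_opp (x : R) : tan_over_id (- x) = tan_over_id x.
Proof.
  destruct (Req_dec_T x 0) as [->|Hx]; [now rewrite Ropp_0|].
  rewrite !tan_over_id_nz, tan_neg by lra. field. exact Hx.
Qed.

Lemma tan_over_id_gt0 (x : R) : 0 <= x < PI / 2 -> 0 < tan_over_id x.
Proof.
  intros [[H0|<-] H1].
  - rewrite tan_over_id_nz by lra. apply Rdiv_lt_0_compat; [apply tan_gt_0|]; lra.
  - rewrite tan_over_id_0. lra.
Qed.

(** Away from [0] the function is the difference quotient of [tan] at [0], and [tan] has derivative
    [1] there. *)
Lemma continuity_pt_tan_over_id_0 : continuity_pt tan_over_id 0.
Proof.
  assert (Hd : derivable_pt_lim tan 0 1).
  { apply is_derive_Reals. unfold tan. auto_derive.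
    - rewrite cos_0. lra.
    - rewrite sin_0, cos_0. field. }
  intros eps Heps. destruct (Hd eps Heps) as [d Hd'].
  exists d. split; [apply d|]. intros x [[_ Hx] Hxd].
  simpl in *. unfold R_dist in *. rewrite tan_over_id_0, tan_over_id_nz by auto.
  rewrite Rminus_0_r in Hxd. specialize (Hd' x ltac:(auto) Hxd).
  now rewrite tan_0, Rplus_0_l, Rminus_0_r in Hd'.
Qed.

(** * The logarithmic gap: derivative, continuity and sign *)

Definition log_gap (a x : R) : R := ln (tan_over_id x) - a * ln (pi_ratio x).

Lemma log_gap_0 (a : R) : log_gap a 0 = 0.
Proof. unfold log_gap. rewrite tan_over_id_0, pi_ratio_0, ln_1. ring. Qed.

Lemma is_derive_log_gap (a x : R) : 0 < x < PI / 2 ->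
  is_derive (log_gap a) x (2 / sin (2 * x) - 1 / x - a * (8 * x / (PI ^ 2 - 4 * x ^ 2))).
Proof.
  intros Hx.
  apply is_derive_ext_loc with
    (fun x => ln (sin x / cos x / x) - a * ln (PI ^ 2 / (PI ^ 2 - 4 * x ^ 2))).
  (* The ball of radius [x] around [x] avoids [0], so the case distinction in [tan_over_id]
     disappears on it. *)
  { exists (mkposreal x (proj1 Hx)). intros y Hy.
    apply Rabs_def2 in Hy. simpl in Hy. unfold minus, plus, opp in Hy. simpl in Hy.
    unfold log_gap. now rewrite tan_over_id_nz by lra. }
  pose proof (sin_gt_0 x ltac:(lra) ltac:(lra)) as Hs.
  pose proof (cos_gt_0 x ltac:(lra) ltac:(lra)) as Hc.
  assert (HD : 0 < PI ^ 2 - 4 * x ^ 2) by nra.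
  pose proof PI_RGT_0 as HP.
  assert (0 < PI ^ 2) by nra.
  auto_derive.
  - repeat split; try lra.
    + apply Rdiv_lt_0_compat; [apply Rdiv_lt_0_compat|]; lra.
    + apply Rdiv_lt_0_compat; lra.
  - rewrite sin_2a. pose proof (sin2_cos2 x) as E. unfold Rsqr in E.
    field_simplify_eq; [|repeat split; lra].
    replace (sin x ^ 2) with (1 - cos x ^ 2) by lra. ring.
Qed.

Lemma continuity_pt_log_gap (a x : R) : 0 <= x < PI / 2 -> continuity_pt (log_gap a) x.
Proof.
  intros [[H0|<-] H1].
  - apply continuity_pt_filterlim, (ex_derive_continuous (V := R_NormedModule)).
    eexists. now apply is_derive_log_gap.
  - apply continuity_pt_minus.
    + refine (continuity_pt_comp tan_over_id ln 0 continuity_pt_tan_over_id_0 _).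
      apply derivable_continuous_pt. exists (/ tan_over_id 0).
      apply derivable_pt_lim_ln. rewrite tan_over_id_0. lra.
    + apply (continuity_pt_filterlim (fun x => a * ln (pi_ratio x))).
      apply (ex_derive_continuous (V := R_NormedModule) (fun x => a * ln (pi_ratio x))).
      unfold pi_ratio. auto_derive.
      pose proof PI_RGT_0. repeat split; try nra.
      apply Rdiv_lt_0_compat; nra.
Qed.

Lemma log_gap_PI2_12_ge0 (x : R) : 0 < x < PI / 2 -> 0 <= log_gap (PI ^ 2 / 12) x.
Proof.
  intros Hx. rewrite <- (log_gap_0 (PI ^ 2 / 12)).
  eapply le_of_derive_nonneg; [lra | | | ].
  - intros y Hy. apply is_derive_log_gap. lra.
  - intros y Hy. apply continuity_pt_log_gap. lra.
  - intros y Hy. cbv beta.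
    pose proof (sin_gt_0 (2 * y) ltac:(lra) ltac:(lra)) as Hs.
    pose proof (sin_le_rational (2 * y) ltac:(lra)) as H.
    assert (HD : 0 < PI ^ 2 - 4 * y ^ 2) by nra.
    (* Over a common denominator, the numerator is the slack in [sin_le_rational] at [2 * y]. *)
    replace (2 / sin (2 * y) - 1 / y - PI ^ 2 / 12 * (8 * y / (PI ^ 2 - 4 * y ^ 2)))
      with ((6 * (2 * y) * (PI ^ 2 - (2 * y) ^ 2)
              - sin (2 * y) * (6 * PI ^ 2 + (PI ^ 2 - 6) * (2 * y) ^ 2))
            / (6 * y * sin (2 * y) * (PI ^ 2 - 4 * y ^ 2)))
      by (field; repeat split; lra).
    apply Rdiv_le_0_compat; [lra|].
    repeat apply Rmult_lt_0_compat; lra.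
Qed.

Lemma log_gap_1_le0 (x : R) : 0 < x < PI / 2 -> log_gap 1 x <= 0.
Proof.
  intros Hx.
  enough (- log_gap 1 0 <= - log_gap 1 x) by (rewrite log_gap_0 in *; lra).
  eapply (le_of_derive_nonneg (fun x => - log_gap 1 x)); [lra | | | ].
  - intros y Hy. apply (is_derive_opp (log_gap 1)), is_derive_log_gap. lra.
  - intros y Hy. apply continuity_pt_opp, continuity_pt_log_gap. lra.
  - intros y Hy. cbv beta. unfold opp. simpl.
    pose proof (sin_gt_0 (2 * y) ltac:(lra) ltac:(lra)) as Hs.
    pose proof (redheffer (2 * y) ltac:(lra)) as H.
    assert (HD : 0 < PI ^ 2 - 4 * y ^ 2) by nra.
    match goal with |- 0 <= ?e => replace e
      with ((sin (2 * y) * (PI ^ 2 + (2 * y) ^ 2) - 2 * y * (PI ^ 2 - (2 * y) ^ 2))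
            / (y * sin (2 * y) * (PI ^ 2 - 4 * y ^ 2)))
      by (field; repeat split; lra) end.
    apply Rdiv_le_0_compat; [lra|].
    repeat apply Rmult_lt_0_compat; lra.
Qed.

Lemma exp_le_exp (u v : R) : u <= v -> exp u <= exp v.
Proof. intros [H|<-]; [left; now apply exp_increasing | apply Rle_refl]. Qed.

Lemma tan_over_id_bounds (x : R) : Rabs x < PI / 2 ->
  Rpower (pi_ratio x) (PI ^ 2 / 12) <= tan_over_id x <= Rpower (pi_ratio x) 1.
Proof.
  assert (Hpos : forall x, 0 < x < PI / 2 ->
    Rpower (pi_ratio x) (PI ^ 2 / 12) <= tan_over_id x <= Rpower (pi_ratio x) 1).
  { intros y Hy.
    pose proof (log_gap_PI2_12_ge0 y Hy) as H1. pose proof (log_gap_1_le0 y Hy) as H2.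
    unfold log_gap in H1, H2. unfold Rpower.
    rewrite <- (exp_ln (tan_over_id y)) by (apply tan_over_id_gt0; lra).
    split; apply exp_le_exp; lra. }
  (* Both functions are even, so negative [x] reduces to the positive case. *)
  intros Hx. destruct (Rtotal_order x 0) as [H|[->|H]].
  - rewrite Rabs_left in Hx by exact H.
    rewrite <- pi_ratio_opp, <- tan_over_id_opp. apply Hpos. lra.
  - rewrite pi_ratio_0, tan_over_id_0. unfold Rpower. rewrite ln_1, !Rmult_0_r, exp_0. lra.
  - rewrite Rabs_right in Hx by lra. apply Hpos. lra.
Qed.

(** * Optimality of the two exponents *)

Lemma ln_le_sub1 (u : R) : 0 < u -> ln u <= u - 1.
Proof. intros Hu. pose proof (exp_ineq1_le (ln u)) as H. rewrite exp_ln in H; lra. Qed.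

(** A quantitative form of [tan x / x = 1 + x^2/3 + ...], from the quintic bound on sine and with
    the quadratic lower bound of cosine kept as a multiplier to avoid division. *)
Lemma tan_over_id_le (x : R) : 0 < x <= 1 ->
  (tan_over_id x - 1) * (1 - x ^ 2 / 2) <= x ^ 2 * (1 / 3 + x ^ 2 / 120).
Proof.
  intros Hx. pose proof PI_bounds.
  pose proof (sin_le_poly5 x ltac:(lra)) as Hs.
  pose proof (cos_ge_poly2 x ltac:(lra)) as Hc.
  assert (0 < 1 - x ^ 2 / 2) by nra.
  enough (tan_over_id x * (1 - x ^ 2 / 2) <= 1 - x ^ 2 / 6 + x ^ 4 / 120) by lra.
  apply Rle_trans with (tan_over_id x * cos x).
  { apply Rmult_le_compat_l; [|lra]. left. apply tan_over_id_gt0. lra. }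
  rewrite tan_over_id_nz by lra. unfold tan.
  replace (sin x / cos x / x * cos x) with (sin x / x) by (field; lra).
  apply (Rmult_le_reg_r x); [lra|]. unfold Rdiv at 1. rewrite Rmult_assoc, Rinv_l; lra.
Qed.

Lemma left_exponent_le (p : R) :
  (forall x, Rabs x < PI / 2 -> Rpower (pi_ratio x) p <= tan_over_id x) ->
  p <= PI ^ 2 / 12.
Proof.
  intros Hp. apply Rnot_lt_le. intros Hlt. pose proof PI_bounds as HPI.
  assert (HP : 0 < PI ^ 2) by nra.
  (* The excess of the [x ^ 2] coefficient of [Rpower (pi_ratio x) p] over that of [tan x / x]. *)
  set (d := p * 4 / PI ^ 2 - 1 / 3).
  assert (Hd : 0 < d).
  { unfold d. replace (p * 4 / PI ^ 2 - 1 / 3) with ((p - PI ^ 2 / 12) * 4 / PI ^ 2) by (field; lra).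
    apply Rdiv_lt_0_compat; lra. }
  (* Small enough to refute [H4] below, which would force [d <= x^2 * (1/120 + 1/6 + d/2)], while
     [x^2 <= 1] and [x^2 <= d/4]. *)
  set (x := Rmin 1 (d / 4)).
  assert (Hx1 : 0 < x <= 1 /\ x <= d / 4).
  { unfold x. repeat split; [apply Rmin_glb_lt; lra | apply Rmin_l | apply Rmin_r]. }
  destruct Hx1 as [Hx Hxd].
  assert (Hxa : Rabs x < PI / 2) by (rewrite Rabs_right; lra).
  specialize (Hp x Hxa). pose proof (tan_over_id_le x Hx) as Ht.
  pose proof (tan_over_id_gt0 x ltac:(lra)) as Htp.
  pose proof (pi_ratio_ge1 x Hxa) as Hr.
  apply ln_le in Hp; [|apply exp_pos]. unfold Rpower in Hp. rewrite ln_exp in Hp.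
  pose proof (ln_le_sub1 _ Htp) as H1.
  (* A lower bound on the logarithm comes from applying [ln u <= u - 1] to the reciprocal. *)
  assert (H2 : 4 * x ^ 2 / PI ^ 2 <= ln (pi_ratio x)).
  { pose proof (ln_le_sub1 (/ pi_ratio x) ltac:(apply Rinv_0_lt_compat; lra)) as H.
    rewrite ln_Rinv in H by lra.
    replace (/ pi_ratio x) with (1 - 4 * x ^ 2 / PI ^ 2) in H; [lra|].
    unfold pi_ratio. field. split; nra. }
  assert (H3 : (1 / 3 + d) * x ^ 2 <= tan_over_id x - 1).
  { replace ((1 / 3 + d) * x ^ 2) with (p * (4 * x ^ 2 / PI ^ 2)) by (unfold d; field; lra).
    apply Rle_trans with (p * ln (pi_ratio x)); [|lra].
    apply Rmult_le_compat_l; lra. }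
  assert (Hx2 : 0 < x ^ 2 <= x) by nra.
  apply (Rmult_le_compat_r (1 - x ^ 2 / 2)) in H3; [|lra].
  assert (H4 : (1 / 3 + d) * (1 - x ^ 2 / 2) <= 1 / 3 + x ^ 2 / 120).
  { apply (Rmult_le_reg_l (x ^ 2)); lra. }
  nra.
Qed.

Lemma right_exponent_ge (q : R) :
  (forall x, Rabs x < PI / 2 -> tan_over_id x <= Rpower (pi_ratio x) q) -> 1 <= q.
Proof.
  intros Hq. apply Rnot_lt_le. intros Hlt. pose proof PI_bounds as HPI.
  (* [r] replaces [q] so that upper bounds on [ln (pi_ratio x)] can be multiplied by it. *)
  set (r := Rmax q 0).
  assert (Hr : 0 <= r < 1).
  { unfold r. split; [apply Rmax_r | apply Rmax_lub_lt; lra]. }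
  assert (HlnPI : 0 < ln PI) by (rewrite <- ln_1; apply ln_increasing; lra).
  (* At distance [exp (- L)] from [PI / 2] both logarithms are within [ln PI] of [L] on the relevant
     side, giving [L - ln PI <= r * (L + ln PI)]. Taking [(1 - r) * L > 2 * ln PI] contradicts
     this. *)
  set (L := 1 + 2 * ln PI / (1 - r)).
  assert (HL0 : 0 < 2 * ln PI / (1 - r)) by (apply Rdiv_lt_0_compat; lra).
  assert (HL : 2 * ln PI < (1 - r) * L).
  { replace ((1 - r) * L) with ((1 - r) + 2 * ln PI) by (unfold L; field; lra). lra. }
  set (t := exp (- L)).
  assert (Ht0 : 0 < t) by apply exp_pos.
  assert (Ht1 : t < 1) by (rewrite <- exp_0; apply exp_increasing; unfold L; lra).
  assert (Hlt' : ln t = - L) by apply ln_exp.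
  set (x := PI / 2 - t).
  assert (Hx : 0 < x < PI / 2) by (unfold x; lra).
  assert (Hxa : Rabs x < PI / 2) by (rewrite Rabs_right; lra).
  specialize (Hq x Hxa). pose proof (pi_ratio_ge1 x Hxa) as Hge.
  pose proof (tan_over_id_gt0 x ltac:(lra)) as Htp.
  apply ln_le in Hq; [|exact Htp]. unfold Rpower in Hq. rewrite ln_exp in Hq.
  assert (Hln : 0 <= ln (pi_ratio x)) by (rewrite <- ln_1; apply ln_le; lra).
  (* Here [pi_ratio x = PI^2 / (4 * t * (PI - t))], and [4 * (PI - t) >= PI] because [t < 1]. *)
  assert (Hupper : ln (pi_ratio x) <= ln PI + L).
  { replace (ln PI + L) with (ln (PI / t)) by (rewrite ln_div by lra; lra).
    apply ln_le; [lra|]. unfold pi_ratio, x.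
    replace (PI ^ 2 - 4 * (PI / 2 - t) ^ 2) with (4 * t * (PI - t)) by field.
    apply (Rmult_le_reg_r (4 * t * (PI - t))); [nra|].
    replace (PI ^ 2 / (4 * t * (PI - t)) * (4 * t * (PI - t))) with (PI ^ 2) by (field; lra).
    replace (PI / t * (4 * t * (PI - t))) with (PI * (4 * (PI - t))) by (field; lra).
    nra. }
  (* Here [tan x = cos t / sin t], with [sin t < t] and [PI * cos t >= PI / 2 > x], as
     [cos t >= 1/2] for [t < 1]. *)
  assert (Hlower : L - ln PI <= ln (tan_over_id x)).
  { assert (HPt : 0 < PI * t) by (apply Rmult_lt_0_compat; lra).
    replace (L - ln PI) with (ln (/ (PI * t)))
      by (rewrite ln_Rinv, ln_mult by lra; lra).
    apply ln_le; [apply Rinv_0_lt_compat; lra|].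
    rewrite tan_over_id_nz by lra. unfold tan, x. rewrite cos_shift, sin_shift.
    pose proof (cos_ge_poly2 t ltac:(lra)) as Hc.
    pose proof (sin_gt_0 t ltac:(lra) ltac:(lra)) as Hs.
    pose proof (sin_lt_x t Ht0) as Hst.
    fold x.
    apply (Rmult_le_reg_r (PI * t * x * sin t)); [apply Rmult_lt_0_compat; [apply Rmult_lt_0_compat|]; lra|].
    replace (/ (PI * t) * (PI * t * x * sin t)) with (x * sin t) by (field; lra).
    replace (cos t / sin t / x * (PI * t * x * sin t)) with (PI * cos t * t) by (field; lra).
    apply Rmult_le_compat; nra. }
  assert (q * ln (pi_ratio x) <= r * ln (pi_ratio x)).
  { apply Rmult_le_compat_r; [lra | apply Rmax_l]. }
  assert (r * ln (pi_ratio x) <= r * (ln PI + L)) by (apply Rmult_le_compat_l; lra).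
  assert (r * ln PI <= 1 * ln PI) by (apply Rmult_le_compat_r; lra).
  lra.
Qed.

Theorem theorem6 :
  (forall x : R, Rabs x < PI / 2 ->
     Rpower (pi_ratio x) (PI ^ 2 / 12) <= tan_over_id x <= Rpower (pi_ratio x) 1)
  /\ (forall p : R,
        (forall x : R, Rabs x < PI / 2 -> Rpower (pi_ratio x) p <= tan_over_id x) ->
        p <= PI ^ 2 / 12)
  /\ (forall q : R,
        (forall x : R, Rabs x < PI / 2 -> tan_over_id x <= Rpower (pi_ratio x) q) ->
        1 <= q).
Proof.
  repeat split.
  - now apply tan_over_id_bounds.
  - now apply tan_over_id_bounds.
  - exact left_exponent_le.
  - exact right_exponent_ge.
Qed.
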